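(* Let $d$, $n$, $r$ be positive integers with $\gcd(d,n)=1$ and $n$ odd. Then, modulo $(1-aq^{r+d\langle -r/d\rangle_n})(1-bq^{d-r+d\langle (r-d)/d\rangle_n})$, $$ \sum_{k=0}^{n-1}\frac{(aq^r;q^d)_k\,(bq^{d-r};q^d)_k\,(x;q^{d})_k\, q^{dk}}{(q^d;q^d)_k\,(abq^{2d};q^{2d})_k} \equiv (-1)^{\langle -r/d\rangle_n}\sum_{k=0}^{n-1}\frac{(aq^r;q^d)_k\,(bq^{d-r};q^d)_k\,(-x;q^{d})_k\, q^{dk}}{(q^d;q^d)_k\,(abq^{2d};q^{2d})_k}. $$
   Context: $a,b,q,x$ are indeterminates. The $q$-shifted factorial is $(y;q)_0=1$ and $(y;q)_m=(1-y)(1-yq)\cdots(1-yq^{m-1})$ for $m\geqslant1$. $\langle y\rangle_m$ denotes the least non-negative residue modulo $m$ of a rational number $y$ whose denominator is coprime to $m$. For rational functions $A,B$ and a polynomial $P$, $A\equiv B\pmod P$ means $A-B=P\cdot C/D$ for polynomials $C,D$ with $D$ coprime to $P$. *)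

(* Defs.v *)
From HB Require Import structures.
From mathcomp Require Import all_boot all_order all_algebra.
Set Implicit Arguments. Unset Strict Implicit. Unset Printing Implicit Defensive.
Import Order.TTheory GRing.Theory Num.Theory.
Local Open Scope ring_scope.

Definition Ra := {poly rat}.
Definition Rb := {poly Ra}.
Definition Rq := {poly Rb}.
Definition P4 := {poly Rq}.
Definition K := {fraction P4}.

Definition toK (p : P4) : K := @FracField.tofrac _ p.

Definition pa : P4 := ((('X : Ra)%:P : Rb)%:P : Rq)%:P.
Definition pb : P4 := ((('X : Rb)%:P : Rq))%:P.
Definition pq : P4 := ('X : Rq)%:P.
Definition px : P4 := 'X.

Definition a : K := toK pa.
Definition b : K := toK pb.
Definition q : K := toK pq.
Definition x : K := toK px.

Definition qpoch (y p : K) (m : nat) : K := \prod_(i < m) (1 - y * p ^+ i).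

Definition dvdP (g p : P4) : Prop := exists h : P4, p = g * h.
Definition coprimeP (p d : P4) : Prop :=
  forall g : P4, dvdP g p -> dvdP g d -> g \is a GRing.unit.

Definition congr_mod (A B : K) (P : P4) : Prop :=
  exists C D : P4, coprimeP P D /\ toK D != 0 /\ A - B = toK P * toK C / toK D.

(* <y>_m : least non-negative residue mod m of the rational y
   (meaningful when denq y is coprime to m): the least s in [0,m)
   with y == s mod m, i.e. m divides the numerator of y - s. *)
Definition lres (y : rat) (m : nat) : nat :=
  find (fun s : nat => ((m%:Z) %| numq (y - s%:Q))%Z) (iota 0 m).

(* the polynomial 1 - c q^e; for negative e (where 1 - c q^e is not a
   polynomial) we use its associate q^(-e) - c (differing by the unit -q^e
   in Q(a,b,q,x), coprime to everything relevant). *)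
Definition one_minus_qpow (c : P4) (e : int) : P4 :=
  match e with
  | Posz k => 1 - c * pq ^+ k
  | Negz k => pq ^+ k.+1 - c
  end.

(* Main.v *)
Require Import Defs.
From HB Require Import structures.
From mathcomp Require Import all_boot all_order all_algebra.
From mathcomp Require Import ring zify.
Import Order.TTheory GRing.Theory Num.Theory.
Local Open Scope ring_scope.

(** Put [p = q ^+ d]. Modulo the first factor, [a * q ^+ r] becomes [p ^- N], and
    the sum is, up to normalisation, a big q-Jacobi polynomial of degree [N] in
    [x]; its three-term recurrence has no constant term, so it has the parity of
    [N]. Modulo the second factor the roles of [a] and [b] are exchanged and [N]
    is replaced by [M], where [N + M = n - 1] is even, so the sign is the same.
    The congruence follows because each factor generates the kernel of the
    corresponding evaluation. *)

Set Implicit Arguments. Unset Strict Implicit. Unset Printing Implicit Defensive.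

(** * Parity in [y] of the terminating sum *)

Section Parity.
Variable F : fieldType.
Implicit Types p c u w y : F.

(* [qpoch] is convertible to [poch] at the field [K]. *)
Definition poch y p m : F := \prod_(i < m) (1 - y * p ^+ i).

Lemma pochS y p m : poch y p m.+1 = poch y p m * (1 - y * p ^+ m).
Proof. exact: big_ord_recr. Qed.

Lemma poch0 y p : poch y p 0 = 1.
Proof. exact: big_ord0. Qed.

Lemma pochSl y p m : poch y p m.+1 = (1 - y) * poch (y * p) p m.
Proof.
rewrite /poch big_ord_recl expr0 mulr1; congr (_ * _).
by apply: eq_bigr => i _; rewrite exprS mulrA.
Qed.

Lemma poch_eq0 y p m N : (N < m)%N -> y * p ^+ N = 1 -> poch y p m = 0.
Proof.
move=> Nm yN; by rewrite /poch (bigD1 (Ordinal Nm)) //= yN subrr mul0r.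
Qed.

Lemma poch_neq0 y p m :
  (forall i, (i < m)%N -> y * p ^+ i != 1) -> poch y p m != 0.
Proof.
move=> yp; apply/prodf_neq0 => i _; rewrite subr_eq0 eq_sym.
exact: yp.
Qed.

(** In the theorem [p], [u], [w], [c] stand for $q^d$, $aq^r$, $bq^{d-r}$, $abq^{2d}$, so that
    [u * w * p = c]; the recurrence rests on this relation. The factor [poch y p k] stays outside as
    a basis element. *)
Definition qsum_coef p c u w k : F :=
  poch u p k * poch w p k * p ^+ k / (poch p p k * poch c (p ^+ 2) k).

Definition qsum p c u w y m : F :=
  \sum_(k < m) qsum_coef p c u w k * poch y p k.

Lemma qsum_coef0 p c u w : qsum_coef p c u w 0 = 1.
Proof. by rewrite /qsum_coef !poch0 expr0 !mulr1 divr1. Qed.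

Lemma qsumC p c u w y m : qsum p c u w y m = qsum p c w u y m.
Proof. by apply: eq_bigr => k _; rewrite /qsum_coef (mulrC (poch u _ _)). Qed.

Lemma qsumS p c u w y m :
  qsum p c u w y m.+1 = qsum p c u w y m + qsum_coef p c u w m * poch y p m.
Proof. exact: big_ord_recr. Qed.

Section Recurrence.
Variables p c : F.
Hypothesis p0 : p != 0.
Hypothesis pm : forall i, (0 < i)%N -> p ^+ i != 1.
Hypothesis cm : forall i, c * p ^+ i != 1.
Hypothesis cp : c != p.

Lemma poch_pp_neq0 k : poch p p k != 0.
Proof. by apply: poch_neq0 => i _; rewrite -exprS pm. Qed.

Lemma poch_cpp_neq0 k : poch c (p ^+ 2) k != 0.
Proof. by apply: poch_neq0 => i _; rewrite -exprM cm. Qed.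

(* The recurrence compared on the basis [poch y p k], in which multiplication by
   [y] is [y * p ^+ k * poch y p k = poch y p k - poch y p k.+1]. *)
Lemma qsum_coef_rec u w k : u != 0 -> u * w * p = c ->
  (1 - w) * qsum_coef p c (u / p) (w * p) k.+1
    + w * (1 - u^-1) * qsum_coef p c (u * p) (w / p) k.+1
  = (1 - w / u) * (qsum_coef p c u w k.+1 / p ^+ k.+1
                   - qsum_coef p c u w k / p ^+ k).
Proof.
move=> u0 uw.
(* All shifted factorials are reduced to [poch u p k] and [poch w p k]; the prefactors [1 - w] and
   [1 - u^-1] supply the missing first factors for [w * p] and [u * p]. *)
have E1 : poch (u / p) p k.+1 = (1 - u / p) * poch u p k.
  by rewrite pochSl divfK.
have E2 : (1 - w) * poch (w * p) p k.+1
          = poch w p k * (1 - w * p ^+ k) * (1 - w * p ^+ k.+1).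
  by rewrite -pochSl !pochS.
have E3 : (1 - u) * poch (u * p) p k.+1
          = poch u p k * (1 - u * p ^+ k) * (1 - u * p ^+ k.+1).
  by rewrite -pochSl !pochS.
have E4 : poch (w / p) p k.+1 = (1 - w / p) * poch w p k.
  by rewrite pochSl divfK.
have pp := poch_pp_neq0 k.+1; have cc := poch_cpp_neq0 k.+1.
have -> : (1 - w) * qsum_coef p c (u / p) (w * p) k.+1 =
   (1 - u / p) * poch u p k
   * (poch w p k * (1 - w * p ^+ k) * (1 - w * p ^+ k.+1))
   * p ^+ k.+1 / (poch p p k.+1 * poch c (p ^+ 2) k.+1).
  by rewrite -E1 -E2 /qsum_coef; ring.
have -> : w * (1 - u^-1) * qsum_coef p c (u * p) (w / p) k.+1 =
   - (w / u) * (poch u p k * (1 - u * p ^+ k) * (1 - u * p ^+ k.+1)) *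
   ((1 - w / p) * poch w p k)
   * p ^+ k.+1 / (poch p p k.+1 * poch c (p ^+ 2) k.+1).
  by rewrite -E3 -E4 /qsum_coef; field; rewrite pp cc u0.
rewrite /qsum_coef !pochS in pp cc *.
move: pp cc; rewrite !mulf_eq0 !negb_or => /andP[pp1 pp2] /andP[cc1 cc2].
have pk0 : p ^+ k != 0 by rewrite expf_neq0.
(* With [c] replaced by [u * w * p] and all powers written through [p ^+ k], a rational identity
   remains. *)
rewrite -uw in cc1; rewrite -exprM mulnC exprM -uw in cc2 *.
rewrite exprS in pp2 *.
move: (poch u p k) (poch w p k) (poch p p k) (poch (u * w * p) _ k)
  pp1 cc1 pp2 cc2 pk0.
move: (p ^+ k) => P A B C D C0 D0 h1 h2 P0.
by field; rewrite P0 D0 C0 p0 h2 h1 u0.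
Qed.

(** Summation by parts of [qsum_coef_rec] against [poch y p j]: the differences
    [poch y p j - poch y p j.+1] produce [y] times the sum, plus one term at the upper end. *)
Lemma qsum_rec_boundary u w y k : u != 0 -> u * w * p = c ->
  (1 - w) * qsum p c (u / p) (w * p) y k.+1
    + w * (1 - u^-1) * qsum p c (u * p) (w / p) y k.+1
  = (1 - w / u) * (y * qsum p c u w y k.+1
                   + qsum_coef p c u w k / p ^+ k * poch y p k.+1).
Proof.
move=> u0 uw; elim: k => [|k IH].
  rewrite !qsumS /qsum !big_ord0 !qsum_coef0 pochS !poch0 expr0.
  by field; rewrite oner_neq0 u0.
rewrite 3!(qsumS _ _ _ _ _ k.+1).
rewrite (mulrDr (1 - w)) (mulrDr (w * _)) addrACA IH.
rewrite [X in _ + X](_ : _ = (1 - w / u) * (qsum_coef p c u w k.+1 / p ^+ k.+1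
                   - qsum_coef p c u w k / p ^+ k) * poch y p k.+1); last first.
  by rewrite -qsum_coef_rec //; ring.
have pk0 : p ^+ k.+1 != 0 by rewrite expf_neq0.
have pk1 : p ^+ k != 0 by rewrite expf_neq0.
rewrite (pochS y p k.+1).
move: (poch y p k.+1) (p ^+ k.+1) (p ^+ k) pk0 pk1 => A B C B0 C0.
by field; rewrite u0 B0 C0.
Qed.

(** Replacing [u = p ^- N] by [u / p] or [u * p] moves [N] up or down by one and keeps
    [u * w * p = c]. In the resulting recurrence the sum for [N] occurs only with the factor [y], so
    the parity alternates, starting from the constant 1 at [N = 0]. *)
Lemma qsum_parity m N y : (N < m)%N ->
  qsum p c (p ^- N) (c / p * p ^+ N) (- y) m
  = (-1) ^+ N * qsum p c (p ^- N) (c / p * p ^+ N) y m.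
Proof.
pose S k z := qsum p c (p ^- k) (c / p * p ^+ k) z m.
(* For positive [k] this is [1 - c * p ^+ k.-1]; for [k = 0] it is [1 - c / p], where [cp]
   enters. *)
have cN k : 1 - c / p * p ^+ k != 0.
  rewrite subr_eq0 eq_sym; case: k => [|k].
    by rewrite mulr1 -(inj_eq (mulIf p0)) divfK // mul1r.
  by rewrite exprS mulrA divfK.
(* At [k = 0] the truncated [k.-1] is harmless, because its coefficient [1 - (p ^- 0)^-1] is
   zero. *)
have rec k z : (k.+1 < m)%N ->
  S k.+1 z = (1 - c / p * p ^+ k)^-1 *
   ((1 - c / p * p ^+ k / p ^- k) * (z * S k z)
    - (c / p * p ^+ k) * (1 - (p ^- k)^-1) * S k.-1 z).
  case: m @S => // m' S km; have pk0 : p ^+ k != 0 by rewrite expf_neq0.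
  (* Since [k < m'], the product [poch (p ^- k) p m'] contains a zero factor and the boundary term
     drops out. *)
  have bd : qsum_coef p c (p ^- k) (c / p * p ^+ k) m' = 0.
    by rewrite /qsum_coef (@poch_eq0 _ _ _ k) ?mul0r ?mulVf.
  have := @qsum_rec_boundary (p ^- k) (c / p * p ^+ k) z m'.
  rewrite bd !mul0r addr0 -/(S k z) invr_eq0 => /(_ pk0) <-; last first.
    by field; rewrite p0 pk0.
  rewrite -invfM -exprSr -[c / p * _ * p]mulrA -exprSr -/(S k.+1 z).
  case: k {bd pk0} km => [|k] _.
    by rewrite expr0 !invr1 subrr !mulr0 !mul0r addr0 subr0 mulKf // -(expr0 p).
  have -> : p ^- k.+1 * p = p ^- k by rewrite exprSr invfM divfK.
  rewrite -[c / p * _ / p]mulrA exprSr mulfK // -exprSr -/(S k z) /=.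
  by rewrite addrK mulKf.
rewrite -/(S N (- y)) -/(S N y).
(* The recurrence has order two, so the induction carries two consecutive indices. *)
suff: (N < m)%N -> (S N (- y) = (-1) ^+ N * S N y) /\
   (S N.-1 (- y) = (-1) ^+ N.-1 * S N.-1 y) by move=> h /h [].
elim: N => [|N IH] Nm.
  have S0 z : S 0%N z = 1.
    rewrite /S {S rec}; case: m Nm => // m' _.
    rewrite /qsum big_ord_recl qsum_coef0 poch0 mulr1 big1 ?addr0 // => i _.
    by rewrite /qsum_coef (@poch_eq0 _ _ _ 0%N) ?mul0r // mulr1 invr1.
  by rewrite /= !S0 expr0 mulr1.
have [E1 E2] := IH (ltnW Nm).
split => //=.
rewrite !rec // E1 E2.
case: N {IH Nm E1 E2} => [|N]; rewrite ?expr0 ?invr1 ?subrr; first ring.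
rewrite /= !exprS; ring.
Qed.
End Recurrence.
End Parity.

(** * Least residues modulo [n] *)

(** In [numq y * d = m * denq y] both [d] and its divisor [denq y] are prime to [n], so Gauss's
    lemma removes each of them. *)
Lemma dvdz_numq_div (m : int) (d n : nat) : (0 < d)%N -> coprime d n ->
  (n%:Z %| numq (m%:Q / d%:Q))%Z = (n%:Z %| m)%Z.
Proof.
move=> d0 dn; set y := _ / _.
have E : numq y * d%:Z = m * denq y.
  apply: (@intr_inj rat); rewrite !rmorphM /= numqE /y.
  by field; rewrite pnatr_eq0 -lt0n.
have cop : coprimez d%:Z n%:Z by rewrite coprimezE.
have dd : (denq y %| d%:Z)%Z.
  by rewrite -(Gauss_dvdzr _ (_ : coprimez _ (numq y))) ?E ?dvdz_mull //
    coprimezE coprime_sym coprime_num_den.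
have cd : coprimez n%:Z (denq y).
  by apply: coprimez_dvdr dd _; rewrite coprimez_sym.
by rewrite -(Gauss_dvdzl (numq y) (_ : coprimez _ d%:Z)) ?E ?Gauss_dvdzl //
  coprimez_sym.
Qed.

(** Clearing [d] turns the search predicate of [lres] into a congruence between [m] and [d * s]; as
    [d] is invertible modulo [n], the search succeeds. *)
Lemma lres_divP (m : int) (d n : nat) : (0 < d)%N -> (0 < n)%N -> coprime d n ->
  (lres (m%:Q / d%:Q) n < n)%N /\ (n%:Z %| m - (d * lres (m%:Q / d%:Q) n)%:Z)%Z.
Proof.
move=> d0 n0 dn; set P := fun s : nat => (n%:Z %| m - (d * s)%:Z)%Z.
have lE : lres (m%:Q / d%:Q) n = find P (iota 0 n).
  apply: eq_find => s; rewrite /P -(dvdz_numq_div (m - _) d0) //.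
  congr (_ %| numq _)%Z.
  by rewrite rmorphB /= PoszM rmorphM /=; field; rewrite pnatr_eq0 -lt0n.
have hP : has P (iota 0 n).
  have [u [v uv]] : exists u v : int, u * d%:Z + v * n%:Z = 1.
    have /coprimezP[[u v] /= uv] : coprimez d%:Z n%:Z by rewrite coprimezE.
    by exists u, v.
  have n0' : n%:Z != 0 by rewrite -lt0n.
  (* By Bezout [u] inverts [d] modulo [n], so the residue of [m * u] is a solution. *)
  apply/hasP; exists `|((m * u) %% n%:Z)%Z|%N.
    rewrite mem_iota /= add0n -ltz_nat gez0_abs ?modz_ge0 //.
    by rewrite ltz_pmod.
  rewrite /P PoszM gez0_abs ?modz_ge0 //.
  apply/dvdzP; exists (m * v + d%:Z * ((m * u) %/ n%:Z)%Z).
  have := divz_eq (m * u) n%:Z; move: (_ %/ _)%Z (_ %% _)%Z => A B AB.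
  have -> : B = m * u - A * n%:Z by rewrite AB addrAC subrr add0r.
  by rewrite -[X in X - _]mulr1 -uv; ring.
split; first by rewrite lE -[X in (_ < X)%N](size_iota 0 n) -has_find.
have := nth_find 0%N hP; rewrite -lE nth_iota ?add0n //.
by rewrite lE -[X in (_ < X)%N](size_iota 0 n) -has_find.
Qed.

(** Adding the congruences for [- r] and [r - d] shows that [n] divides [d * (N + M + 1)], hence
    [N + M + 1], which lies strictly between 0 and [2 * n]. *)
Lemma lres_complement (d n r : nat) : (0 < d)%N -> (0 < n)%N -> coprime d n ->
  (lres (- r%:Q / d%:Q) n + lres ((r%:Q - d%:Q) / d%:Q) n = n.-1)%N.
Proof.
move=> d0 n0 dn.
have := lres_divP (- r%:Z) d0 n0 dn; have := lres_divP (r%:Z - d%:Z) d0 n0 dn.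
rewrite !(rmorphB, rmorphN) /=.
move: (lres _ _) (lres _ _) => N M [Mn h1] [Nn h2].
have : (n%:Z %| d%:Z * (N + M).+1%:Z)%Z.
  rewrite -rpredN.
  have -> : - (d%:Z * (N + M).+1%:Z)
    = (r%:Z - d%:Z - (d * M)%:Z) + (- r%:Z - (d * N)%:Z) by lia.
  exact: rpredD.
rewrite Gauss_dvdzr; last by rewrite coprimezE coprime_sym.
rewrite dvdzE /= => /dvdnP [k kE].
have : (k < 2)%N by nia.
case: k kE => [|[|]] //; lia.
Qed.

(** * Evaluation homomorphisms from [P4] to [K] *)

HB.instance Definition _ := GRing.RMorphism.copy toK (@FracField.tofrac P4).

Lemma toK_eq0 f : (toK f == 0) = (f == 0).
Proof. exact: tofrac_eq0. Qed.

Lemma toK_inj : injective toK.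
Proof. by move=> f g /eqP; rewrite tofrac_eq => /eqP. Qed.

Definition constP (t : rat) : P4 := (((t%:P : Ra)%:P : Rb)%:P : Rq)%:P.

HB.instance Definition _ := GRing.RMorphism.copy constP
  ((((@polyC Rq) \o (@polyC Rb)) \o (@polyC Ra)) \o (@polyC rat)).

Section Extend.
Variables (R : nzRingType) (f : {rmorphism R -> K}) (v : K).

Definition extend_eval : {poly R} -> K :=
  @horner_morph R K f v (fun c => mulrC v (f c)).

HB.instance Definition _ := GRing.RMorphism.on extend_eval.

Lemma extend_evalX : extend_eval 'X = v.
Proof. exact: horner_morphX. Qed.

Lemma extend_evalC c : extend_eval c%:P = f c.
Proof. exact: horner_morphC. Qed.
End Extend.

(** The target is the field [K], since [a] or [b] will be sent to a possibly negative power of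
    [q]. *)
Definition evalP (va vb vq vx : K) : {rmorphism P4 -> K} :=
  @extend_eval Rq (@extend_eval Rb (@extend_eval Ra
    (@extend_eval rat (toK \o constP) va) vb) vq) vx.

Section Eval.
Variables va vb vq vx : K.
Let ev := evalP va vb vq vx.

Lemma evalP_const t : ev (constP t) = toK (constP t).
Proof.
exact: (etrans (extend_evalC _ _ _) (etrans (extend_evalC _ _ _)
  (etrans (extend_evalC _ _ _) (extend_evalC _ _ _)))).
Qed.

Lemma evalP_a : ev pa = va.
Proof.
exact: (etrans (extend_evalC _ _ _) (etrans (extend_evalC _ _ _)
  (etrans (extend_evalC _ _ _) (extend_evalX _ _)))).
Qed.

Lemma evalP_b : ev pb = vb.
Proof.
exact: (etrans (extend_evalC _ _ _) (etrans (extend_evalC _ _ _) (extend_evalX _ _))).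
Qed.

Lemma evalP_q : ev pq = vq.
Proof. exact: (etrans (extend_evalC _ _ _) (extend_evalX _ _)). Qed.

Lemma evalP_x : ev px = vx.
Proof. exact: (extend_evalX _ _). Qed.
End Eval.

(** The morphism [h] embeds one polynomial layer into [P4], so the induction can be iterated through
    the four nested layers. *)
Lemma poly_closed_ind (R : nzRingType) (h : {rmorphism {poly R} -> P4})
    (Q : P4 -> Prop) :
  (forall c, Q (h c%:P)) -> Q (h 'X) ->
  (forall f g, Q f -> Q g -> Q (f + g)) ->
  (forall f g, Q f -> Q g -> Q (f * g)) -> forall f, Q (h f).
Proof.
move=> Qc QX QD QM; elim/poly_ind => [|f c IH].
  by rewrite -(polyC0 R); apply: Qc.
by rewrite rmorphD rmorphM; apply: QD; [apply: QM|apply: Qc].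
Qed.

Lemma P4_ind (Q : P4 -> Prop) :
  (forall t, Q (constP t)) -> Q pa -> Q pb -> Q pq -> Q px ->
  (forall f g, Q f -> Q g -> Q (f + g)) ->
  (forall f g, Q f -> Q g -> Q (f * g)) -> forall f, Q f.
Proof.
move=> Qc Qa Qb Qq Qx QD QM.
have Ha := @poly_closed_ind rat ((@polyC Rq \o @polyC Rb) \o @polyC Ra) Q Qc Qa QD QM.
have Hb := @poly_closed_ind Ra (@polyC Rq \o @polyC Rb) Q Ha Qb QD QM.
have Hq := @poly_closed_ind Rb (@polyC Rq) Q Hb Qq QD QM.
exact: (@poly_closed_ind Rq idfun Q Hq Qx QD QM).
Qed.

(** * Kernels of the evaluations *)

Section Kernel.
Variables (ev : {rmorphism P4 -> K}) (P : P4).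

(* Modulo [P], the element [U] is a unit and [U * f] is a [g] that [ev] does not
   change; if [ev f = 0] then [g = 0], hence [P] divides [f]. *)
Definition kernel_red f :=
  exists U V h g h' : P4,
    [/\ U * f = P * h + g, ev g = toK g, ev U = toK U & U * V = 1 + P * h'].

Lemma kernel_red_fixed f : ev f = toK f -> kernel_red f.
Proof.
by move=> ef; exists 1, 1, 0, f, 0; rewrite !rmorph1; split=> //; ring.
Qed.

(** The multiplier [U1 * U2] has inverse [V1 * V2] modulo [P]; the last witness comes from expanding
    [(1 + P * k1) * (1 + P * k2)]. *)
Lemma kernel_redD f1 f2 : kernel_red f1 -> kernel_red f2 -> kernel_red (f1 + f2).
Proof.
move=> [U1 [V1 [h1 [g1 [k1 [E1 eg1 eU1 UV1]]]]]].
move=> [U2 [V2 [h2 [g2 [k2 [E2 eg2 eU2 UV2]]]]]].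
exists (U1 * U2), (V1 * V2), (U2 * h1 + U1 * h2), (U2 * g1 + U1 * g2).
exists (k1 + k2 + P * k1 * k2); split.
- have -> : U1 * U2 * (f1 + f2) = U2 * (U1 * f1) + U1 * (U2 * f2) by ring.
  by rewrite E1 E2; ring.
- by rewrite !(rmorphD, rmorphM) eg1 eg2 eU1 eU2.
- by rewrite !rmorphM eU1 eU2.
- by rewrite mulrACA UV1 UV2; ring.
Qed.

Lemma kernel_redM f1 f2 : kernel_red f1 -> kernel_red f2 -> kernel_red (f1 * f2).
Proof.
move=> [U1 [V1 [h1 [g1 [k1 [E1 eg1 eU1 UV1]]]]]].
move=> [U2 [V2 [h2 [g2 [k2 [E2 eg2 eU2 UV2]]]]]].
exists (U1 * U2), (V1 * V2), (P * h1 * h2 + g1 * h2 + h1 * g2), (g1 * g2).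
exists (k1 + k2 + P * k1 * k2); split.
- by rewrite mulrACA E1 E2; ring.
- by rewrite !rmorphM eg1 eg2.
- by rewrite !rmorphM eU1 eU2.
- by rewrite mulrACA UV1 UV2; ring.
Qed.

Lemma kernel_red_dvd f : kernel_red f -> ev P = 0 -> ev f = 0 -> dvdP P f.
Proof.
move=> [U [V [h [g [k [E eg eU UV]]]]]] eP ef.
have g0 : g = 0.
  apply/eqP; rewrite -toK_eq0 -eg.
  rewrite -[g](addKr (P * h)) -E rmorphD rmorphN !rmorphM.
  by rewrite eP ef !(mul0r, mulr0) oppr0 addr0.
(* Multiplying [U * f = P * h] by [V] gives [f + P * k * f = P * V * h]. *)
exists (V * h - k * f); rewrite g0 addr0 in E.
have fE : f = V * (U * f) - P * k * f by rewrite mulrA (mulrC V) UV; ring.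
by rewrite {1}fE E; ring.
Qed.

(** Reducible elements are closed under sums and products, so constants and the four indeterminates
    suffice. *)
Lemma kernel_dvd : kernel_red pa -> kernel_red pb -> kernel_red pq ->
  kernel_red px -> (forall t, kernel_red (constP t)) -> ev P = 0 ->
  forall f, ev f = 0 -> dvdP P f.
Proof.
move=> ra rb rq rx rc eP f; apply: kernel_red_dvd eP.
apply: P4_ind f => //; [exact: kernel_redD | exact: kernel_redM].
Qed.
End Kernel.

(** For [e >= 0] the indeterminate [z] is inverse to [pq ^+ e] modulo the factor, which forces the
    multiplier [U = pq ^+ e]; for negative [e] it is congruent to a power of [pq] and [U = 1]
    suffices. *)
Lemma kernel_red_root (ev : {rmorphism P4 -> K}) (z : P4) (e : int) :
  ev pq = q -> kernel_red ev (one_minus_qpow z e) z.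
Proof.
move=> eq; case: e => k /=.
  exists (pq ^+ k), z, (-1), 1, (-1); rewrite !rmorph1 !rmorphXn /= eq.
  by split=> //; ring.
exists 1, 1, (-1), (pq ^+ k.+1), 0; rewrite !rmorph1 !rmorphXn /= eq.
by split=> //; ring.
Qed.

Lemma q_neq0 : q != 0.
Proof. by rewrite toK_eq0 !polyC_eq0 polyX_eq0. Qed.

Lemma eval_one_minus_qpow va vb vx (z : P4) (e : int) :
  evalP va vb q vx z = q ^ (- e) -> evalP va vb q vx (one_minus_qpow z e) = 0.
Proof.
case: e => k /= ez; rewrite rmorphB ?rmorph1 ?rmorphM rmorphXn /= evalP_q ez.
  by rewrite (exprnP q k) -expfzDr ?q_neq0 // addNr expr0z subrr.
by rewrite NegzE opprK subrr.
Qed.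

Lemma kernel_eval_a (e : int) f :
  evalP (q ^ (- e)) b q x f = 0 -> dvdP (one_minus_qpow pa e) f.
Proof.
have eq := evalP_q (q ^ (- e)) b q x.
apply: kernel_dvd.
- exact: kernel_red_root eq.
- by apply: kernel_red_fixed; rewrite evalP_b.
- by apply: kernel_red_fixed; rewrite evalP_q.
- by apply: kernel_red_fixed; rewrite evalP_x.
- by move=> t; apply: kernel_red_fixed; rewrite evalP_const.
- by apply: eval_one_minus_qpow; rewrite evalP_a.
Qed.

Lemma kernel_eval_b (e : int) f :
  evalP a (q ^ (- e)) q x f = 0 -> dvdP (one_minus_qpow pb e) f.
Proof.
have eq := evalP_q a (q ^ (- e)) q x.
apply: kernel_dvd.
- by apply: kernel_red_fixed; rewrite evalP_a.
- exact: kernel_red_root eq.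
- by apply: kernel_red_fixed; rewrite evalP_q.
- by apply: kernel_red_fixed; rewrite evalP_x.
- by move=> t; apply: kernel_red_fixed; rewrite evalP_const.
- by apply: eval_one_minus_qpow; rewrite evalP_b.
Qed.

Lemma qX_neq1 i : (0 < i)%N -> q ^+ i != 1.
Proof.
case: i => // i _; rewrite -rmorphXn -(rmorph1 toK) (inj_eq toK_inj).
apply/eqP => /(congr1 (evalP 0 0 0 0)).
by rewrite rmorphXn rmorph1 /= evalP_q expr0n /= => /eqP; rewrite eq_sym oner_eq0.
Qed.

(** Once a negative power is cleared, setting [z] to 0 would give [0 = 1] or make a power of [q]
    vanish. Both [pa] and [pb] satisfy the hypothesis. *)
Lemma mul_qXz_neq1 (z : P4) (e : int) :
  evalP 0 0 q 0 z = 0 -> toK z * q ^ e != 1.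
Proof.
move=> z0; apply/negP; case: e => k.
  rewrite -exprnP -rmorphXn -rmorphM -(rmorph1 toK) (inj_eq toK_inj) => /eqP.
  move=> /(congr1 (evalP 0 0 q 0)).
  by rewrite rmorphM rmorph1 /= z0 mul0r => /eqP; rewrite eq_sym oner_eq0.
rewrite NegzE -exprnN -(inj_eq (mulIf (expf_neq0 k.+1 q_neq0))) mul1r.
rewrite divfK ?expf_neq0 ?q_neq0 // -rmorphXn (inj_eq toK_inj) => /eqP.
move=> /(congr1 (evalP 0 0 q 0)); rewrite rmorphXn /= z0 evalP_q => /esym/eqP.
by rewrite expf_eq0 /= (negPf q_neq0).
Qed.

(** * Simultaneous specialization of fractions *)

Lemma frac_addE (F : comNzRingType) (y z f g f' g' : F) :
  y * g = f -> z * g' = f' -> (y + z) * (g * g') = f * g' + f' * g.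
Proof. by move=> <- <-; ring. Qed.

Lemma frac_mulE (F : comNzRingType) (y z f g f' g' : F) :
  y * g = f -> z * g' = f' -> (y * z) * (g * g') = f * f'.
Proof. by move=> <- <-; ring. Qed.

Section Specialization.
Variables (R : idomainType) (F : fieldType).
Variables (tk ev1 ev2 : {rmorphism R -> F}).
Hypothesis tk_eq0 : forall f, (tk f == 0) = (f == 0).

(** One representation [f / g] serves both evaluations, so that a single denominator, killed by
    neither, is available for the final congruence. *)
Definition specializes (y z1 z2 : F) :=
  exists f g : R, [/\ ev1 g != 0, ev2 g != 0, y * tk g = tk f,
    z1 * ev1 g = ev1 f & z2 * ev2 g = ev2 f].

Lemma specializes_poly f : specializes (tk f) (ev1 f) (ev2 f).
Proof. by exists f, 1; rewrite !rmorph1 !mulr1 oner_neq0. Qed.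

Lemma specializes1 : specializes 1 1 1.
Proof. by have := specializes_poly 1; rewrite !rmorph1. Qed.

Lemma specializes0 : specializes 0 0 0.
Proof. by have := specializes_poly 0; rewrite !rmorph0. Qed.

Lemma specializesD y y1 y2 z z1 z2 : specializes y y1 y2 ->
  specializes z z1 z2 -> specializes (y + z) (y1 + z1) (y2 + z2).
Proof.
move=> [f [g [g1 g2 E E1 E2]]] [f' [g' [g1' g2' E' E1' E2']]].
exists (f * g' + f' * g), (g * g'); rewrite !rmorphD !rmorphM.
by split; [exact: mulf_neq0|exact: mulf_neq0|exact: frac_addE..].
Qed.

Lemma specializesM y y1 y2 z z1 z2 : specializes y y1 y2 ->
  specializes z z1 z2 -> specializes (y * z) (y1 * z1) (y2 * z2).
Proof.
move=> [f [g [g1 g2 E E1 E2]]] [f' [g' [g1' g2' E' E1' E2']]].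
exists (f * f'), (g * g'); rewrite !rmorphM.
by split; [exact: mulf_neq0|exact: mulf_neq0|exact: frac_mulE..].
Qed.

Lemma specializesN y y1 y2 :
  specializes y y1 y2 -> specializes (- y) (- y1) (- y2).
Proof.
move=> [f [g [g1 g2 E E1 E2]]]; exists (- f), g.
by split=> //; rewrite rmorphN mulNr; congr (- _).
Qed.

Lemma specializesV y y1 y2 : specializes y y1 y2 -> y1 != 0 -> y2 != 0 ->
  specializes y^-1 y1^-1 y2^-1.
Proof.
move=> [f [g [g1 g2 E E1 E2]]] y10 y20; exists g, f.
have f1 : ev1 f != 0 by rewrite -E1 mulf_neq0.
have f0 : tk f != 0.
  by apply: contraNneq f1 => /eqP; rewrite tk_eq0 => /eqP->; rewrite rmorph0.
have y0 : y != 0 by apply: contraNneq f0 => y0; rewrite -E y0 mul0r.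
split; [by []| |by rewrite -E mulKf|by rewrite -E1 mulKf|by rewrite -E2 mulKf].
by rewrite -E2 mulf_neq0.
Qed.

Lemma specializesX y y1 y2 i :
  specializes y y1 y2 -> specializes (y ^+ i) (y1 ^+ i) (y2 ^+ i).
Proof.
move=> yy; elim: i => [|i IH]; first by rewrite !expr0; apply: specializes1.
by rewrite !exprS; apply: specializesM.
Qed.

Lemma specializesXz y y1 y2 (i : int) : y1 != 0 -> y2 != 0 ->
  specializes y y1 y2 -> specializes (y ^ i) (y1 ^ i) (y2 ^ i).
Proof.
move=> y10 y20 yy; case: i => i; first exact: specializesX.
rewrite NegzE -!exprnN; apply: specializesV; rewrite ?expf_neq0 //.
exact: specializesX.
Qed.

Lemma specializes_poch y y1 y2 p p1 p2 k :
  specializes y y1 y2 -> specializes p p1 p2 ->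
  specializes (poch y p k) (poch y1 p1 k) (poch y2 p2 k).
Proof.
move=> yy pp; elim: k => [|k IH]; first by rewrite !poch0; apply: specializes1.
rewrite !pochS; apply: specializesM => //; apply: specializesD.
  exact: specializes1.
by apply/specializesN/specializesM/specializesX.
Qed.

Lemma specializes_qsum p c c1 c2 u u1 u2 w w1 w2 y y1 y2 m :
  specializes p p p -> specializes c c1 c2 -> specializes u u1 u2 ->
  specializes w w1 w2 -> specializes y y1 y2 ->
  (forall k, poch p p k != 0) -> (forall k, poch c1 (p ^+ 2) k != 0) ->
  (forall k, poch c2 (p ^+ 2) k != 0) ->
  specializes (qsum p c u w y m) (qsum p c1 u1 w1 y1 m)
              (qsum p c2 u2 w2 y2 m).
Proof.
move=> pp cc uu ww yy p0 c10 c20; elim: m => [|m IH].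
  by rewrite /qsum !big_ord0; apply: specializes0.
rewrite /qsum !big_ord_recr /=; apply: specializesD => //.
apply: specializesM; last exact: specializes_poch.
apply: specializesM.
  apply: specializesM; last exact: specializesX.
  by apply: specializesM; apply: specializes_poch.
apply: specializesV; rewrite ?mulf_neq0 //.
by apply: specializesM; apply: specializes_poch => //; apply: specializesX.
Qed.

(** Write [A - B] as [f / D] with [f] killed by both evaluations. Then [f = P1 * h], and since
    [ev2 P1] is nonzero, [ev2] kills [h], so [P2] divides [h]. *)
Lemma specializes_congr P1 P2 A B :
  (forall f, ev1 f = 0 -> (exists h, f = P1 * h)) ->
  (forall f, ev2 f = 0 -> (exists h, f = P2 * h)) ->
  ev1 P1 = 0 -> ev2 P2 = 0 -> ev2 P1 != 0 -> ev1 P2 != 0 ->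
  specializes (A - B) 0 0 -> 
  exists C D : R,
    [/\ forall g, (exists h, P1 * P2 = g * h) -> (exists h, D = g * h) ->
         g \is a GRing.unit,
       tk D != 0 & A - B = tk (P1 * P2) * tk C / tk D].
Proof.
move=> k1 k2 e11 e22 e21 e12 [f [D [D1 D2 E E1 E2]]].
have P10 : P1 != 0 by apply: contraNneq e21 => ->; rewrite rmorph0.
have P20 : P2 != 0 by apply: contraNneq e12 => ->; rewrite rmorph0.
have D0 : tk D != 0.
  by apply: contraNneq D1 => /eqP; rewrite tk_eq0 => /eqP->; rewrite rmorph0.
have [h hE] : (exists h, f = P1 * h) by apply: k1; rewrite -E1 mul0r.
have [C CE] : (exists h', h = P2 * h').
  by apply: k2; apply: (mulfI e21); rewrite -rmorphM -hE -E2 mul0r mulr0.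
exists C, D; split=> //; last by rewrite -rmorphM -mulrA -CE -hE -E mulfK.
(* A divisor [g] of [D] is killed by neither evaluation, so in [P1 * P2 = g * h1] both [P1] and [P2]
   divide out of the cofactor, leaving [g * h4 = 1]. *)
move=> g [h1 gh1] [h2 gh2].
have g1 : ev1 g != 0.
  by apply: contraNneq D1 => g0; rewrite gh2 rmorphM g0 mul0r.
have g2 : ev2 g != 0.
  by apply: contraNneq D2 => g0; rewrite gh2 rmorphM g0 mul0r.
have [h3 h3E] : (exists h, h1 = P1 * h).
  by apply: k1; apply: (mulfI g1); rewrite -rmorphM -gh1 rmorphM e11 mul0r mulr0.
have P2E : P2 = g * h3 by apply: (mulfI P10); rewrite gh1 h3E mulrCA.
have [h4 h4E] : (exists h, h3 = P2 * h).
  by apply: k2; apply: (mulfI g2); rewrite -rmorphM -P2E e22 mulr0.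
have u : g * h4 = 1.
  by apply: (mulfI P20); rewrite mulrCA -h4E -P2E mulr1.
by apply/unitrP; exists h4; rewrite mulrC u.
Qed.
End Specialization.

Lemma one_minus_qpow_neq0 (z : P4) (e : int) :
  evalP 0 0 q 0 z = 0 -> one_minus_qpow z e != 0.
Proof.
move=> z0; apply: contraTneq isT => /(congr1 (evalP 0 0 q 0)).
rewrite rmorph0; case: e => k; rewrite [one_minus_qpow _ _]/= rmorphB.
  by rewrite rmorph1 rmorphM z0 mul0r subr0 => /eqP; rewrite oner_eq0.
by rewrite z0 subr0 rmorphXn evalP_q => /eqP; rewrite expf_eq0 (negPf q_neq0).
Qed.

Lemma eval_one_minus_qpow_fixed (ev : {rmorphism P4 -> K}) (z : P4) (e : int) :
  ev pq = q -> ev z = toK z -> ev (one_minus_qpow z e) = toK (one_minus_qpow z e).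
Proof.
move=> eq ez; case: e => k; rewrite [one_minus_qpow _ _]/= !rmorphB.
  by rewrite !rmorph1 !rmorphM !rmorphXn eq ez.
by rewrite !rmorphXn eq ez.
Qed.

(** * Vanishing of the difference of the sums under both evaluations *)

Section Main.
Variables (R : idomainType) (F : fieldType).
Variables (tk ev1 ev2 : {rmorphism R -> F}).
Hypothesis tk_eq0 : forall f, (tk f == 0) = (f == 0).
Variables pA pB pQ pX : R.
Let A := tk pA. Let B := tk pB. Let Q := tk pQ. Let X := tk pX.
Variables d n r N M : nat.
Let e1 : int := (r + d * N)%:Z.
Let e2 : int := d%:Z - r%:Z + (d * M)%:Z.
Hypotheses (ev1A : ev1 pA = Q ^ (- e1)) (ev1B : ev1 pB = B).
Hypotheses (ev1Q : ev1 pQ = Q) (ev1X : ev1 pX = X).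
Hypotheses (ev2A : ev2 pA = A) (ev2B : ev2 pB = Q ^ (- e2)).
Hypotheses (ev2Q : ev2 pQ = Q) (ev2X : ev2 pX = X).
Hypothesis Q0 : Q != 0.
Hypothesis QX1 : forall i, (0 < i)%N -> Q ^+ i != 1.
Hypothesis AQ : forall e : int, A * Q ^ e != 1.
Hypothesis BQ : forall e : int, B * Q ^ e != 1.
Hypotheses (d0 : (0 < d)%N) (n0 : (0 < n)%N) (nodd : odd n).
Hypothesis NM : (N + M = n.-1)%N.

Let S y := qsum (Q ^+ d) (A * B * Q ^+ (2 * d)) (A * Q ^+ r)
                (B * Q ^ (d%:Z - r%:Z)) y n.

(** This is [qsum_parity] at [p = Q ^+ d] and [c = Z * Q ^ e]; the hypothesis on [Z] keeps the
    denominators nonzero and [c] different from [p]. It is applied with [Z] equal to [B], then to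
    [A]. *)
Lemma parity_generic (Z : F) (e : int) (y : F) k :
  (forall e : int, Z * Q ^ e != 1) -> (k < n)%N ->
  qsum (Q ^+ d) (Z * Q ^ e) (Q ^- (d * k)) (Z * Q ^ (e - d%:Z + (d * k)%:Z))
    (- y) n
  = (-1) ^+ k * qsum (Q ^+ d) (Z * Q ^ e) (Q ^- (d * k))
    (Z * Q ^ (e - d%:Z + (d * k)%:Z)) y n.
Proof.
move=> ZQ kn.
have E : Z * Q ^ (e - d%:Z + (d * k)%:Z) = Z * Q ^ e / (Q ^+ d) * (Q ^+ d) ^+ k.
  by rewrite -exprM !expfzDr // -exprnN exprnP !mulrA.
rewrite E exprM; apply: qsum_parity => //.
- by rewrite expf_neq0.
- by move=> i i0; rewrite -exprM QX1 // muln_gt0 d0.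
- by move=> i; rewrite -exprM exprnP -mulrA -expfzDr.
- apply: contraNneq (ZQ (e - d%:Z)) => h.
  by rewrite expfzDr // mulrA h -exprnN mulfV // expf_neq0.
Qed.

Lemma sum_difference_specializes :
  specializes tk ev1 ev2 (S X - (-1) ^+ N * S (- X)) 0 0.
Proof.
have Nn : (N < n)%N by lia.
have Mn : (M < n)%N by lia.
have sg : (-1) ^+ M = (-1) ^+ N :> F.
  have oMN : odd M = odd N by lia.
  by rewrite -[LHS]signr_odd oMN signr_odd.
(* The exponents have the shape that [parity_generic] expects: [w1] equals [B * Q ^ (d - r)] and
   [u2] equals [A * Q ^+ r]. *)
pose c1 := B * Q ^ ((2 * d)%:Z - e1).
pose c2 := A * Q ^ ((2 * d)%:Z - e2).
pose w1 := B * Q ^ ((2 * d)%:Z - e1 - d%:Z + (d * N)%:Z).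
pose u2 := A * Q ^ ((2 * d)%:Z - e2 - d%:Z + (d * M)%:Z).
pose S1 y := qsum (Q ^+ d) c1 (Q ^- (d * N)) w1 y n.
pose S2 y := qsum (Q ^+ d) c2 u2 (Q ^- (d * M)) y n.
have sQ : specializes tk ev1 ev2 Q Q Q.
  by have := specializes_poly tk ev1 ev2 pQ; rewrite ev1Q ev2Q.
have sX : specializes tk ev1 ev2 X X X.
  by have := specializes_poly tk ev1 ev2 pX; rewrite ev1X ev2X.
have sA : specializes tk ev1 ev2 A (Q ^ (- e1)) A.
  by have := specializes_poly tk ev1 ev2 pA; rewrite ev1A ev2A.
have sB : specializes tk ev1 ev2 B B (Q ^ (- e2)).
  by have := specializes_poly tk ev1 ev2 pB; rewrite ev1B ev2B.
have sS y : specializes tk ev1 ev2 y y y ->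
    specializes tk ev1 ev2 (S y) (S1 y) (S2 y).
  move=> sy; have sp := specializesX d sQ.
  have -> : S1 y = qsum (Q ^+ d) (Q ^ (- e1) * B * Q ^+ (2 * d))
                (Q ^ (- e1) * Q ^+ r)
                (B * Q ^ (d%:Z - r%:Z)) y n.
    rewrite /S1; congr qsum.
    - by rewrite /c1 exprnP expfzDr //; ring.
    - by rewrite (exprnP Q r) -expfzDr // exprnN; congr (_ ^ _); lia.
    - by congr (_ * _ ^ _); lia.
  have -> : S2 y = qsum (Q ^+ d) (A * Q ^ (- e2) * Q ^+ (2 * d)) (A * Q ^+ r)
                (Q ^ (- e2) * Q ^ (d%:Z - r%:Z)) y n.
    rewrite /S2; congr qsum.
    - by rewrite /c2 exprnP expfzDr //; ring.
    - by rewrite (exprnP Q r); congr (_ * _ ^ _); lia.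
    - by rewrite -expfzDr // exprnN; congr (_ ^ _); lia.
  have cE (Z : F) (e : int) : (forall e : int, Z * Q ^ e != 1) ->
      forall k, poch (Z * Q ^ e) ((Q ^+ d) ^+ 2) k != 0.
    move=> ZQ k; apply: poch_neq0 => i _.
    by rewrite -!exprM exprnP -mulrA -expfzDr.
  apply: specializes_qsum => //.
  - apply: specializesM; last exact: specializesX.
    exact: specializesM.
  - by apply: specializesM => //; apply: specializesX.
  - by apply: specializesM => //; apply: specializesXz.
  - move=> k; apply: poch_neq0 => i _.
    by rewrite -exprS -exprM QX1 // muln_gt0 d0.
  - have -> : Q ^ (- e1) * B * Q ^+ (2 * d) = c1.
      by rewrite /c1 exprnP expfzDr //; ring.
    exact: cE.
  - have -> : A * Q ^ (- e2) * Q ^+ (2 * d) = c2.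
      by rewrite /c2 exprnP expfzDr //; ring.
    exact: cE.
have sN : specializes tk ev1 ev2 ((-1) ^+ N) ((-1) ^+ N) ((-1) ^+ N).
  by apply/specializesX/specializesN/specializes1.
have signK (t : F) : (-1) ^+ N * ((-1) ^+ N * t) = t.
  by rewrite mulrA -expr2 sqrr_sign mul1r.
have z1 : S1 X - (-1) ^+ N * S1 (- X) = 0.
  by rewrite /S1 parity_generic // signK subrr.
(* Under the second evaluation the terminating parameter is the second one, so the two are exchanged
   first. *)
have z2 : S2 X - (-1) ^+ N * S2 (- X) = 0.
  by rewrite /S2 !(qsumC _ _ u2) parity_generic // sg signK subrr.
have s1 := sS X sX; have s2 := sS (- X) (specializesN sX).
have := specializesD s1
  (specializesN (specializesM sN s2)).
by rewrite z1 z2.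
Qed.
End Main.

(** * The congruence for the original sums over [K] *)

Lemma sum_poch_qsum (F : fieldType) (p u w y c : F) (d n : nat) :
  \sum_(k < n) poch u (p ^+ d) k * poch w (p ^+ d) k * poch y (p ^+ d) k
     * p ^+ (d * k) / (poch (p ^+ d) (p ^+ d) k * poch c (p ^+ (2 * d)) k)
  = qsum (p ^+ d) c u w y n.
Proof.
apply: eq_bigr => k _; rewrite /qsum_coef -[_ ^+ d ^+ 2]exprM (mulnC 2%N) exprM.
by rewrite [RHS]mulrAC [X in _ = X / _]mulrAC.
Qed.

Theorem theorem1p3 (d n r : nat) :
  (0 < d)%N -> (0 < n)%N -> (0 < r)%N -> coprime d n -> odd n ->
  let s1 := lres (- (r%:Q) / d%:Q) n in
  let s2 := lres ((r%:Q - d%:Q) / d%:Q) n in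
  congr_mod
    (\sum_(k < n)
       qpoch (a * q ^+ r) (q ^+ d) k * qpoch (b * q ^ (d%:Z - r%:Z)) (q ^+ d) k
       * qpoch x (q ^+ d) k * q ^+ (d * k)
       / (qpoch (q ^+ d) (q ^+ d) k * qpoch (a * b * q ^+ (2 * d)) (q ^+ (2 * d)) k))
    ((-1) ^+ s1 *
     \sum_(k < n)
       qpoch (a * q ^+ r) (q ^+ d) k * qpoch (b * q ^ (d%:Z - r%:Z)) (q ^+ d) k
       * qpoch (- x) (q ^+ d) k * q ^+ (d * k)
       / (qpoch (q ^+ d) (q ^+ d) k * qpoch (a * b * q ^+ (2 * d)) (q ^+ (2 * d)) k))
    (one_minus_qpow pa (r + d * s1)%:Z * one_minus_qpow pb (d%:Z - r%:Z + (d * s2)%:Z)).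
Proof.
move=> d0 n0 _ dn nodd s1 s2.
have s12 : (s1 + s2 = n.-1)%N := lres_complement r d0 n0 dn.
have sumE := fun y => sum_poch_qsum q (a * q ^+ r) (b * q ^ (d%:Z - r%:Z)) y
  (a * b * q ^+ (2 * d)) d n.
rewrite (sumE x) (sumE (- x)).
set e1 := (r + d * s1)%:Z; set e2 := _ + (d * s2)%:Z.
pose ev1 := evalP (q ^ (- e1)) b q x.
pose ev2 := evalP a (q ^ (- e2)) q x.
have za : evalP 0 0 q 0 pa = 0 by exact: evalP_a.
have zb : evalP 0 0 q 0 pb = 0 by exact: evalP_b.
(* The second evaluation fixes [a] and [q], so it sends this factor to its own nonzero image in [K];
   the other factor is treated symmetrically. *)
have p2 : ev2 (one_minus_qpow pa e1) != 0.
  rewrite eval_one_minus_qpow_fixed; [|exact: evalP_q|exact: evalP_a].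
  by rewrite toK_eq0 one_minus_qpow_neq0.
have p1 : ev1 (one_minus_qpow pb e2) != 0.
  rewrite eval_one_minus_qpow_fixed; [|exact: evalP_q|exact: evalP_b].
  by rewrite toK_eq0 one_minus_qpow_neq0.
have sp := @sum_difference_specializes P4 K toK ev1 ev2 toK_eq0 pa pb pq px d n r
  s1 s2 (evalP_a _ _ _ _) (evalP_b _ _ _ _) (evalP_q _ _ _ _) (evalP_x _ _ _ _)
  (evalP_a _ _ _ _) (evalP_b _ _ _ _) (evalP_q _ _ _ _) (evalP_x _ _ _ _)
  q_neq0 qX_neq1 (fun e => mul_qXz_neq1 e za) (fun e => mul_qXz_neq1 e zb)
  d0 n0 nodd s12.
have [C [D [cop D0 E]]] := @specializes_congr P4 K toK ev1 ev2 toK_eq0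
  (one_minus_qpow pa e1) (one_minus_qpow pb e2) _ _
  (@kernel_eval_a e1) (@kernel_eval_b e2)
  (eval_one_minus_qpow (evalP_a _ _ _ _))
  (eval_one_minus_qpow (evalP_b _ _ _ _)) p2 p1 sp.
by exists C, D.
Qed.
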